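(* Let $y=y(N)\ge 2$ be a real-valued function of the integer $N\geq 2$ satisfying $y(N)=o(\log N)$ as $N\to\infty$. Then, as $N\to\infty$, $$c_{N,y}\sim\frac{1}{\pi(y)!}\prod_{p\leq y}\frac{\log N}{\log p},$$ where the product is over primes $p\le y$.
   Context: $\pi(y)$ is the number of primes up to $y$, $v_p(n)$ is the $p$-adic valuation of $n$, and a positive integer is $y$-smooth if all its prime factors are at most $y$ (so $1$ is $y$-smooth). For $2\le y\le N$, $c_{N,y}$ denotes the Lebesgue volume in $\mathbb{R}^{\pi(y)}$ of the convex hull of the set of exponent vectors $(v_p(n))_{p\leq y}$ of the $y$-smooth positive integers $n\leq N$. *)

(* Defs.v *)
From HB Require Import structures.
From mathcomp Require Import all_boot all_order all_algebra.
From mathcomp Require Import all_classical all_reals all_analysis.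

Set Implicit Arguments.
Unset Strict Implicit.
Unset Printing Implicit Defensive.

Import Order.TTheory GRing.Theory Num.Theory.
Import numFieldNormedType.Exports.

Local Open Scope classical_set_scope.
Local Open Scope ring_scope.

Definition tuple_cons (T : Type) (n : nat) (p : T * n.-tuple T) : n.+1.-tuple T :=
  [tuple of p.1 :: p.2].

(* n-fold product of the one-dimensional Lebesgue measure, on the product
   sigma-algebra of n.-tuple R; in dimension 0 it is the unit mass. *)
Fixpoint lebesgue_tuple (R : realType) (n : nat) :
    set (n.-tuple (measurableTypeR R)) -> \bar R :=
  match n with
  | 0 => \d_[tuple]
  | m.+1 => pushforward (@lebesgue_measure R \x @lebesgue_tuple R m)%E
              (@tuple_cons (measurableTypeR R) m)
  end.

Section lebesgue_tuple_step.
Context (R : realType) (n : nat).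
Local Notation T := (measurableTypeR R).
Variable mu : {sigma_finite_measure set (n.-tuple T) -> \bar R}.

Local Notation prod_mu := (@lebesgue_measure R \x mu)%E.

Let step := pushforward prod_mu (@tuple_cons T n).

Let measurable_tuple_cons : measurable_fun [set: T * n.-tuple T] (@tuple_cons T n).
Proof. exact: measurable_cons. Qed.

Let step0 : step set0 = 0%E.
Proof. by rewrite /step /pushforward preimage_set0 measure0. Qed.

Let step_ge0 A : (0 <= step A)%E.
Proof. exact: measure_ge0. Qed.

Let step_sigma_additive : semi_sigma_additive step.
Proof.
move=> F mF tF mUF; rewrite /step /pushforward preimage_bigcup.
apply: measure_semi_sigma_additive.
- by move=> k; rewrite -[X in measurable X]setTI; exact: measurable_tuple_cons.
- apply/trivIsetP => /= i j _ _ ij; rewrite -preimage_setI.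
  by move/trivIsetP : tF => /(_ _ _ _ _ ij) ->//; rewrite preimage_set0.
- by rewrite -preimage_bigcup -[X in measurable X]setTI; exact: measurable_tuple_cons.
Qed.

HB.instance Definition _ := isMeasure.Build _ _ _
  step step0 step_ge0 step_sigma_additive.

Let tuple_uncons (t : n.+1.-tuple T) : T * n.-tuple T :=
  (thead t, [tuple of behead t]).

Let tuple_consK : cancel (@tuple_cons T n) tuple_uncons.
Proof. by case=> x t; congr (_, _); apply/val_inj. Qed.

Let measurable_tuple_uncons : measurable_fun [set: n.+1.-tuple T] tuple_uncons.
Proof.
apply/measurable_fun_pairP; split; first exact: measurable_tnth.
exact: measurable_behead.
Qed.

Let step_sigma_finite : sigma_finite setT step.
Proof.
have /sigma_finiteP[F [TF ndF Foo]] := sigma_finiteT (@lebesgue_measure R).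
have /sigma_finiteP[G [TG ndG Goo]] := sigma_finiteT mu.
exists (fun k => tuple_uncons @^-1` (F k `*` G k)).
  apply/esym; rewrite -subTset => t _.
  have [i _ Fi] : (\bigcup_i F i) (tuple_uncons t).1 by rewrite -TF.
  have [j _ Gj] : (\bigcup_j G j) (tuple_uncons t).2 by rewrite -TG.
  exists (maxn i j) => //; split.
  - by move: Fi; exact/subsetPset/ndF/leq_maxl.
  - by move: Gj; exact/subsetPset/ndG/leq_maxr.
move=> k; have [mFk Fk] := Foo k; have [mGk Gk] := Goo k; split.
  rewrite -[X in measurable X]setTI; apply: measurable_tuple_uncons => //.
  exact: measurableX.
rewrite /step /pushforward -comp_preimage.
rewrite (_ : _ \o _ = id); last by apply/funext => p; rewrite /= tuple_consK.
by rewrite preimage_id product_measure1E// lte_mul_pinfty// ge0_fin_numE.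
Qed.

HB.instance Definition _ := Measure_isSigmaFinite.Build _ _ _ step step_sigma_finite.

Lemma lebesgue_tuple_step :
  exists nu : {sigma_finite_measure set (n.+1.-tuple T) -> \bar R},
    nu = pushforward (@lebesgue_measure R \x mu)%E (@tuple_cons T n)
      :> (set (n.+1.-tuple T) -> \bar R).
Proof. by exists step. Qed.

End lebesgue_tuple_step.

Lemma lebesgue_tuple_sigma_finite_measure (R : realType) (n : nat) :
  exists mu : {sigma_finite_measure set (n.-tuple (measurableTypeR R)) -> \bar R},
    mu = @lebesgue_tuple R n :> (set (n.-tuple (measurableTypeR R)) -> \bar R).
Proof.
elim: n => [|n [mu muE]].
  by exists (dirac ([tuple] : 0.-tuple (measurableTypeR R))
    : {sigma_finite_measure set _ -> \bar R}).
by rewrite /= -muE; exact: lebesgue_tuple_step.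
Qed.

Lemma lebesgue_tuple_box (R : realType) (n : nat)
    (A : 'I_n -> set (measurableTypeR R)) : (forall i, measurable (A i)) ->
  lebesgue_tuple [set t | forall i, A i (tnth t i)] =
  (\prod_(i < n) lebesgue_measure (A i))%E.
Proof.
elim: n A => [|n IH] A mA.
  by rewrite big_ord0 /= diracE mem_set//= => -[].
have mB : measurable
    [set t : n.-tuple (measurableTypeR R) | forall i, A (lift ord0 i) (tnth t i)].
  rewrite (_ : [set _ | _] = \bigcap_(i in [set: 'I_n])
      ((@tnth n (measurableTypeR R))^~ i @^-1` A (lift ord0 i))); last first.
    by apply/seteqP; split=> t /= h i; [move=> _; exact: h|exact: h].
  apply: fin_bigcap_measurable => // i _.
  by rewrite -[X in measurable X]setTI; exact: measurable_tnth.
have [mu muE] := lebesgue_tuple_sigma_finite_measure R n.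
rewrite big_ord_recl -IH// /= -muE -product_measure1E// /pushforward.
congr product_measure1; apply/seteqP; split=> -[x t] /=.
  move=> h; split=> /=; first by have := h ord0; rewrite tnth0.
  by move=> i; have := h (lift ord0 i); rewrite tnthS.
case=> /= h0 h i; case: (unliftP ord0 i) => [j ->|->]; last by rewrite tnth0.
by rewrite tnthS.
Qed.

Section convex_hull.
Context (R : realType) (n : nat).

(* Only meant for Borel sets, such as the (compact) hull of a finite set. *)
Definition volume (A : set 'rV[R]_n) : \bar R :=
  lebesgue_tuple [set t | A (\row_i tnth t i)].

Definition convex_hull (S : set 'rV[R]_n) : set 'rV[R]_n :=
  smallest (@convex_set R 'rV[R]_n) S.

End convex_hull.

Section smooth.
Context (R : realType).

Definition primes_upto (y : R) : seq nat :=
  [seq p <- iota 0 (Num.truncn y).+1 | prime p].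

Lemma mem_primes_upto (y : R) (p : nat) : 0 <= y ->
  (p \in primes_upto y) = prime p && (p%:R <= y).
Proof.
move=> y0; rewrite mem_filter mem_iota /= add0n ltnS; congr (_ && _).
by rewrite truncn_ge_nat.
Qed.

Definition prime_pi (y : R) : nat := size (primes_upto y).

Definition smooth (y : R) (n : nat) : Prop :=
  (0 < n)%N /\ forall p : nat, prime p -> (p %| n)%N -> p%:R <= y.

(* Coordinate i is the valuation at the i-th smallest prime, counting from 0. *)
Definition exponent_vector (y : R) (n : nat) : 'rV[R]_(prime_pi y) :=
  \row_i (logn (nth 0%N (primes_upto y) i) n)%:R.

(* The volume is finite, so fine loses nothing. *)
Definition exponent_volume (N : nat) (y : R) : R :=
  fine (volume (convex_hull
    [set exponent_vector y n | n in [set n | smooth y n /\ (n <= N)%N]])).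

End smooth.

(* Main.v *)
(* Write k for the number of primes up to y. An exponent vector v of n <= N has
   sum_p v_p log p <= log N, so the hull lies in a simplex of volume
   (1/k!) prod_p (log N / log p). Conversely the hull contains the origin and,
   on each axis, the point b_p = floor (log N / log p) coming from n = p^(b_p),
   hence a simplex of volume (1/k!) prod_p b_p. The ratio of the two volumes is
   at least prod_p (1 - log p / log N) >= 1 - theta(y) / log N, and Chebyshev's
   bound theta(y) <= y log 4 = o(log N) makes it tend to 1. *)

Require Import Defs.
From HB Require Import structures.
From mathcomp Require Import all_boot all_order all_algebra.
From mathcomp Require Import all_classical all_reals all_analysis.
From mathcomp Require Import ring lra.
Import Order.TTheory GRing.Theory Num.Theory.
Import numFieldNormedType.Exports.
Local Open Scope classical_set_scope.
Local Open Scope ring_scope.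

(** * Lebesgue measure on tuples and the volume of a simplex *)

Lemma le_nnintegral d (T : measurableType d) (R : realType)
    (mu : {measure set T -> \bar R}) (f g : T -> \bar R) :
  (forall x, 0 <= f x)%E -> (forall x, f x <= g x)%E ->
  (\int[mu]_x f x <= \int[mu]_x g x)%E.
Proof.
move=> f0 fg; rewrite !ge0_integralTE => [|x|//]; last exact: le_trans (fg x).
apply: ereal_sup_le => _ [h hf <-]; exists h => // x.
exact: le_trans (fg x).
Qed.

Section lebesgue_tuple.
Context {R : realType}.
Local Notation T := (measurableTypeR R).

Lemma lebesgue_tuple_ge0 (n : nat) (A : set (n.-tuple T)) :
  (0 <= lebesgue_tuple A)%E.
Proof.
by have [mu <-] := lebesgue_tuple_sigma_finite_measure R n.
Qed.

Lemma lebesgue_tupleS (n : nat) (A : set (n.+1.-tuple T)) :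
  lebesgue_tuple A = (\int[lebesgue_measure]_x
    lebesgue_tuple [set t : n.-tuple T | A [tuple of x :: t]])%E.
Proof.
apply: eq_integral => x _ /=; congr lebesgue_tuple.
by apply/seteqP; split=> t /=; rewrite /xsection /= inE.
Qed.

(* No measurability is needed: the integral of a nonnegative function is a
   supremum over the simple functions below it. *)
Lemma le_lebesgue_tuple (n : nat) (A B : set (n.-tuple T)) :
  A `<=` B -> (lebesgue_tuple A <= lebesgue_tuple B)%E.
Proof.
elim: n A B => [|n IH] A B AB.
  rewrite /= !diracE lee_fin ler_nat.
  by have [/set_mem /AB /mem_set ->|] := boolP (_ \in A).
rewrite !lebesgue_tupleS; apply: le_nnintegral => x.
  exact: lebesgue_tuple_ge0.
by apply: IH => t /=; exact: AB.
Qed.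

(** This is the integral met when a simplex is sliced along one axis: the slice at [x] has size
    [s - c * x], and [K] collects the constants of the lower dimension. *)
Lemma integral_affine_exp (c s K : R) (n : nat) : 0 < c -> 0 <= s ->
  (\int[lebesgue_measure]_(x in `[0%R, (s / c)%R]) ((s - c * x) ^+ n * K)%R%:E =
   (s ^+ n.+1 * K / (c * n.+1%:R))%R%:E)%E.
Proof.
(* For [s = 0] the interval is a single point; the fundamental theorem of calculus is kept for
   [0 < s / c]. *)
move=> c0; rewrite le_eqVlt => /orP[/eqP <-|s0].
  by rewrite mul0r set_itv1 integral_set1 expr0n !mul0r.
pose Q : {poly R} := s%:P - c *: 'X.
(* [P] is a polynomial primitive of the integrand, and it vanishes at the endpoint [s / c]. *)
pose P : {poly R} := - (K / (c * n.+1%:R)) *: Q ^+ n.+1.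
have QE x : Q.[x] = s - c * x by rewrite !hornerE.
have P'E x : P^`().[x] = (s - c * x) ^+ n * K.
  rewrite derivZ deriv_exp /= derivB derivC derivZ derivX sub0r.
  rewrite hornerZ hornerMn hornerM horner_exp QE hornerN hornerZ hornerC.
  rewrite -mulr_natr; field.
  by rewrite nat1r pnatr_eq0 (gt_eqF c0).
have sc0 : 0 < s / c by rewrite divr_gt0.
rewrite (@continuous_FTC2 _ _ (horner P)) //.
- rewrite !hornerZ !horner_exp !QE mulr0 subr0.
  rewrite [c * (s / c)]mulrC divfK ?gt_eqF//.
  rewrite subrr expr0n mulr0 -EFinB sub0r; congr EFin.
  by rewrite mulNr opprK; field; rewrite nat1r pnatr_eq0 (gt_eqF c0).
- apply: continuous_subspaceT => x.
  rewrite (_ : (fun _ => _) = horner P^`()); last by apply/funext => ?.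
  exact: continuous_horner.
- split=> [x _||]; first exact: derivable_horner.
    by apply: cvg_at_right_filter; exact: continuous_horner.
  by apply: cvg_at_left_filter; exact: continuous_horner.
- by move=> x _; rewrite -derivE P'E.
Qed.

(** General [c] and [s] make the family stable under slicing. The weights are later [ln p] with
    [s = ln N] for the outer simplex, and the inverses of the axis lengths with [s = 1] for the
    inner one. *)
Definition simplex_tuple {n : nat} (c : 'I_n -> R) (s : R) : set (n.-tuple T) :=
  [set t | (forall i, 0 <= tnth t i) /\ \sum_i c i * tnth t i <= s].

(** Induction on the dimension: the slice at first coordinate [x] is a simplex with the remaining
    weights and bound [s - c ord0 * x]. *)
Lemma lebesgue_simplex_tuple (n : nat) (c : 'I_n -> R) (s : R) :
  (forall i, 0 < c i) -> 0 <= s ->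
  lebesgue_tuple (simplex_tuple c s) = (s ^+ n / (n`!%:R * \prod_i c i))%:E.
Proof.
elim: n c s => [|n IH] c s c_gt0 s_ge0.
  rewrite /= diracE mem_set; first by rewrite big_ord0 fact0 mulr1 expr0 divr1.
  by split=> [[]//|]; rewrite big_ord0.
have c0 := c_gt0 ord0.
pose c' i := c (lift ord0 i).
have c'_gt0 i : 0 < c' i by exact: c_gt0.
pose K : R := (n`!%:R * \prod_i c' i)^-1.
have sectionE x : [set t : n.-tuple T | simplex_tuple c s [tuple of x :: t]] =
    [set t | 0 <= x /\ simplex_tuple c' (s - c ord0 * x) t].
  apply/seteqP; split=> t /=.
    case=> t_ge0; rewrite big_ord_recl tnth0 => sum_le.
    split; first by have := t_ge0 ord0; rewrite tnth0.
    split=> [i|]; first by have := t_ge0 (lift ord0 i); rewrite tnthS.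
    rewrite lerBrDl; apply: le_trans sum_le; rewrite lerD2l.
    by under [leRHS]eq_bigr do rewrite tnthS.
  case=> x_ge0 [t_ge0 sum_le]; split=> [i|].
    by case: (unliftP ord0 i) => [j ->|->]; rewrite ?tnth0 ?tnthS.
  rewrite big_ord_recl tnth0 -lerBrDl; apply: le_trans sum_le.
  by under eq_bigr do rewrite tnthS.
rewrite lebesgue_tupleS.
transitivity (\int[@lebesgue_measure R]_(x in `[0%R, (s / c ord0)%R])
    ((s - c ord0 * x) ^+ n * K)%R%:E)%E; last first.
  rewrite integral_affine_exp// big_ord_recl factS natrM /K !invfM.
  congr EFin; field.
  rewrite nat1r !pnatr_eq0 (gt_eqF c0) -lt0n fact_gt0 !andbT.
  by rewrite gt_eqF// prodr_gt0.
rewrite [RHS]integral_mkcond; apply: eq_integral => x _.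
rewrite sectionE patchE; case: ifPn => [/set_mem|].
  rewrite /= in_itv/= ler_pdivlMr// mulrC => /andP[x_ge0 x_le].
  rewrite -/K -IH ?subr_ge0//; congr lebesgue_tuple.
  by apply/seteqP; split=> t /= [].
(* Outside the interval the slice is empty: either [x] is negative, or the bound left for a
   nonnegative sum is. *)
rewrite notin_setE /= in_itv/= ler_pdivlMr// mulrC => /negP/nandP x_out.
rewrite (_ : [set _ | _] = set0).
  by have [mu <-] := lebesgue_tuple_sigma_finite_measure R n; rewrite measure0.
rewrite -subset0 => t /= [x_ge0 [t_ge0 sum_le]].
case: x_out => [/negP//|]; rewrite -subr_ge0 => /negP; apply.
apply: le_trans sum_le; apply: sumr_ge0 => i _.
by rewrite mulr_ge0// ltW.
Qed.

End lebesgue_tuple.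

(** * Convex combinations of several points *)

Section convex.
Context {R : realType} {V : lmodType R} {A : set V}.
Hypothesis cA : convex_set (A : set (convex_lmodType V)).

Lemma convex_set_comb (x y : V) (w : R) :
  0 <= w <= 1 -> A x -> A y -> A (w *: x + (1 - w) *: y).
Proof.
move=> /andP[w0 w1] Ax Ay; have := cA x y (Itv01 w0 w1).
by rewrite !inE => /(_ Ax Ay).
Qed.

(** The weight missing from 1 is carried by the origin. In the induction the first point is split
    off and the other weights are divided by [1 - w i], so that they again sum to at most 1. *)
Lemma convex_set_sum (I : Type) (r : seq I) (w : I -> R) (v : I -> V) :
  A 0 -> (forall i, A (v i)) -> (forall i, 0 <= w i) ->
  \sum_(i <- r) w i <= 1 -> A (\sum_(i <- r) w i *: v i).
Proof.
move=> A0 Av; elim: r w => [|i r IH] w w_ge0; first by rewrite !big_nil.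
rewrite !big_cons => sum_le.
have sum_ge0 : 0 <= \sum_(j <- r) w j by exact: sumr_ge0.
(* If [w i = 1], this division is impossible, but then all other weights vanish. *)
have [wi1|wi1] := eqVneq (w i) 1.
  have /eqP sum0 : \sum_(j <- r) w j == 0.
    by rewrite eq_le sum_ge0 andbT -(lerD2l (w i)) addr0 {2}wi1.
  suff -> : \sum_(j <- r) w j *: v j = 0 by rewrite wi1 scale1r addr0.
  elim: r {IH sum_le sum_ge0} sum0 => [|j r IHr]; first by rewrite !big_nil.
  rewrite !big_cons => /eqP; rewrite paddr_eq0// ?sumr_ge0//.
  by move=> /andP[/eqP -> /eqP /IHr ->]; rewrite scale0r addr0.
have {}wi1 : 0 < 1 - w i by rewrite subr_gt0 lt_neqAle wi1/=; lra.
have -> : \sum_(j <- r) w j *: v j =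
    (1 - w i) *: \sum_(j <- r) (w j / (1 - w i)) *: v j.
  rewrite scaler_sumr; apply: eq_bigr => j _.
  by rewrite scalerA mulrC divfK ?gt_eqF.
apply: convex_set_comb => //; first by rewrite w_ge0/=; lra.
apply: IH => [j|]; first by rewrite divr_ge0// ltW.
by rewrite -mulr_suml ler_pdivrMr// mul1r; lra.
Qed.

End convex.

(** * Chebyshev's bound on the product of the primes up to [n] *)

Lemma prime_Ndvd_fact (p k : nat) : prime p -> (k < p)%N -> ~~ (p %| k`!)%N.
Proof.
move=> p_prime; elim: k => [|k IH] k_lt.
  by rewrite dvdn1 gtn_eqF ?prime_gt1.
by rewrite factS Euclid_dvdM// negb_or gtnNdvd//= IH// ltnW.
Qed.

(** The coefficients at [m] and [m.+1] are equal and are two distinct terms of the expansion of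
    [(1 + 1) ^ m.*2.+1], which is twice [4 ^ m]. *)
Lemma bin_middle_le (m : nat) : ('C(m.*2.+1, m) <= 4 ^ m)%N.
Proof.
have Sm_le : (m.+1 < m.*2.+2)%N by rewrite !ltnS -addnn leq_addr.
have m_le := ltnW Sm_le.
have binE : 'C(m.*2.+1, m.+1) = 'C(m.*2.+1, m).
  by rewrite -bin_sub ?ltnS -addnn ?leq_addr// subSS addnK.
rewrite -(@leq_pmul2r 2)// (_ : 4 ^ m * 2 = 2 ^ m.*2.+1)%N; last first.
  by rewrite expnS mulnC -mul2n expnM.
rewrite -[2%N in X in (_ <= X)%N]/(1 + 1)%N expnDn.
under eq_bigr do rewrite !exp1n !muln1.
rewrite (bigD1 (Ordinal m_le))//= (bigD1 (Ordinal Sm_le))/=; last first.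
  by rewrite -val_eqE/= gtn_eqF.
by rewrite binE addnA addnn muln2 leq_addr.
Qed.

Lemma pairwise_coprime_primes (s : seq nat) :
  uniq s -> all prime s -> pairwise coprime s.
Proof.
elim: s => //= p s IH /andP[p_notin s_uniq] /andP[p_prime s_prime].
rewrite IH// andbT; apply/allP => q q_in.
rewrite prime_coprime// dvdn_prime2// ?(allP s_prime)//.
by apply: contraNneq p_notin => ->.
Qed.

(* For odd n = 2m+1, the primes in ]m+1, 2m+1] all divide C(2m+1, m) <= 4^m. *)
Lemma primorial_le (n : nat) :
  (\prod_(p <- iota 0 n.+1 | prime p) p <= 4 ^ n)%N.
Proof.
elim/ltn_ind: n => n IH.
have [n_le2|n_gt2] := leqP n 2.
  by case: n n_le2 {IH} => [|[|[]]]//= _; rewrite unlock.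
have iotaS m : iota 0 m.+2 = rcons (iota 0 m.+1) m.+1.
  by rewrite -addn1 iotaD cats1.
case: (boolP (odd n)) => [n_odd|n_even]; last first.
  (* An even number above 2 is not prime, so the product is the one for its predecessor. *)
  case: n n_gt2 n_even IH => // n n_gt2 n_even IH.
  rewrite iotaS -cats1 big_cat big_cons big_nil /= ifN.
    rewrite muln1 (leq_trans (IH _ _))// leq_exp2l//.
  apply/negP => /even_prime[n2|]; last by rewrite (negbTE n_even).
  by rewrite n2 in n_gt2.
pose m := n./2.
have nE : n = m.*2.+1 by rewrite -[LHS]odd_double_half n_odd.
have m_gt0 : (0 < m)%N by rewrite -double_gt0 -ltnS -nE; exact: ltnW.
have -> : n.+1 = (m.+2 + m)%N by rewrite nE -addnn.
(* The primes up to [m.+1] contribute at most [4 ^ m.+1] by induction, the others at most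
   [4 ^ m]. *)
rewrite iotaD big_cat /= nE -addnn -addSn expnD.
rewrite leq_mul//; first by apply: IH; rewrite nE ltnS -addnn -addn1 leq_add.
apply: leq_trans (bin_middle_le m); apply: dvdn_leq.
  by rewrite bin_gt0 -addnn -addSn leq_addl.
apply/unstable.Gauss_dvd_prod => [|p].
  rewrite map_id; apply: pairwise_coprime_primes.
    by rewrite filter_uniq// iota_uniq.
  exact: filter_all.
rewrite mem_iota add0n => /andP[p_ge p_lt] p_prime.
(* The factorial is the binomial coefficient times [m!] and [(m+1)!], and [p > m+1] divides neither
   of these two. *)
have : (p %| (m.*2.+1)`!)%N.
  by apply: dvdn_fact; rewrite prime_gt0//= -addnn -ltnS -!addSn.
rewrite -(@bin_fact _ m); last by rewrite -addnn -addSn leq_addl.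
rewrite !Euclid_dvdM// -addnn subSn ?leq_addr// addKn.
by rewrite !(negbTE (prime_Ndvd_fact _ _ _ _)) ?orbF// ltnW// ltnW.
Qed.

(** * Convexity of the hull, and inequalities for products and logarithms *)

Lemma convex_hull_convex (R : realType) (n : nat) (S : set 'rV[R]_n) :
  convex_set (convex_hull S : set (convex_lmodType 'rV[R]_n)).
Proof.
move=> a b w; rewrite !inE => Sa Sb A [cA SA].
by have := cA a b w; rewrite !inE; apply; [exact: Sa|exact: Sb].
Qed.

(** Weierstrass's product inequality: in the induction the cross term [u i * \sum u j] is
    nonnegative and is dropped. *)
Lemma prodr_onem_ge (R : realDomainType) (I : eqType) (r : seq I) (u : I -> R) :
  {in r, forall i, 0 <= u i <= 1} ->
  1 - \sum_(i <- r) u i <= \prod_(i <- r) (1 - u i).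
Proof.
elim: r => [|i r IH] u01; first by rewrite !big_nil subr0.
rewrite !big_cons.
have /andP[ui0 ui1] := u01 i (mem_head _ _).
have {}IH := IH (fun j jr => u01 j (mem_behead (s := i :: r) jr)).
have sum_ge0 : 0 <= \sum_(j <- r) u j.
  rewrite big_seq sumr_ge0// => j jr.
  by case/andP: (u01 j (mem_behead (s := i :: r) jr)).
apply: le_trans (ler_wpM2l _ IH); last by rewrite subr_ge0.
by have := mulr_ge0 ui0 sum_ge0; lra.
Qed.

Lemma sum_ln_nat (R : realType) (I : eqType) (s : seq I) (f : I -> nat) :
  {in s, forall i, 0 < f i}%N ->
  \sum_(i <- s) ln (f i)%:R = ln (\prod_(i <- s) f i)%:R :> R.
Proof.
elim: s => [|i s IH] f_gt0; first by rewrite !big_nil ln1.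
have f_gt0' : {in s, forall j, 0 < f j}%N.
  by move=> j js; rewrite f_gt0// in_cons js orbT.
rewrite !big_cons natrM lnM ?IH// posrE ltr0n; first by rewrite f_gt0 ?mem_head.
by rewrite big_seq prodn_cond_gt0.
Qed.

Lemma ler_ln_nat (R : realType) (m n : nat) : (0 < m)%N -> (m <= n)%N ->
  ln m%:R <= ln n%:R :> R.
Proof.
by move=> m0 mn; rewrite ler_ln ?posrE ?ltr0n ?ler_nat// (leq_trans m0).
Qed.

(** * Upper and lower bounds for the volume of the hull *)

Section exponent_volume.
Context {R : realType}.
Implicit Types (y : R) (N : nat).

Lemma primes_upto_prime y : {in primes_upto y, forall p, prime p}.
Proof. by move=> p; rewrite mem_filter => /andP[]. Qed.

Lemma primes_upto_uniq y : uniq (primes_upto y).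
Proof. by rewrite filter_uniq// iota_uniq. Qed.

Lemma ln_prime_gt0 p : prime p -> 0 < ln p%:R :> R.
Proof. by move=> p_prime; rewrite ln_gt0// ltr1n prime_gt1. Qed.

(** The sum is Chebyshev's theta function, the logarithm of a primorial. *)
Lemma sum_ln_primes_upto_le y : 0 <= y ->
  \sum_(p <- primes_upto y) ln p%:R <= y * ln 4%:R.
Proof.
move=> y_ge0; rewrite sum_ln_nat; last first.
  by move=> p /primes_upto_prime/prime_gt0.
rewrite big_filter (le_trans (ler_ln_nat R _ _ _ (primorial_le _)))//.
  by rewrite prodn_cond_gt0// => p /prime_gt0.
rewrite natrX lnXn ?ltr0n// -[ln _ *+ _]mulr_natl ler_wpM2r//.
  by rewrite ln_ge0// ler1n.
by have /andP[] := truncn_itv y_ge0.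
Qed.

Lemma nth_primes_upto y (i : 'I_(prime_pi y)) :
  nth 0%N (primes_upto y) i \in primes_upto y.
Proof. exact: mem_nth. Qed.

(** Powers of distinct primes are coprime and each divides [n]. Taking logarithms puts exponent
    vectors into the outer simplex. *)
Lemma prod_primes_upto_dvd y n : (0 < n)%N ->
  (\prod_(p <- primes_upto y) p ^ logn p n %| n)%N.
Proof.
move=> n_gt0; apply/unstable.Gauss_dvd_prod => [|p p_in _].
  rewrite filter_predT pairwise_map.
  have := pairwise_coprime_primes _ (primes_upto_uniq y).
  rewrite filter_all => /(_ isT); apply: sub_pairwise => p q.
  by move=> pq /=; rewrite coprimeXl// coprimeXr.
by rewrite pfactor_dvdn// (primes_upto_prime y).
Qed.

Lemma volume_hull_le N y : (0 < N)%N ->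
  (volume (convex_hull
    [set exponent_vector y n | n in [set n | smooth y n /\ (n <= N)%N]]) <=
   ((prime_pi y)`!%:R^-1 *
     \prod_(p <- primes_upto y) (ln N%:R / ln p%:R))%:E)%E.
Proof.
move=> N_gt0.
pose c (i : 'I_(prime_pi y)) : R := ln (nth 0%N (primes_upto y) i)%:R.
have c_gt0 i : 0 < c i.
  by rewrite ln_prime_gt0// (primes_upto_prime y)// nth_primes_upto.
have -> : (prime_pi y)`!%:R^-1 * \prod_(p <- primes_upto y) (ln N%:R / ln p%:R)
    = ln N%:R ^+ prime_pi y / ((prime_pi y)`!%:R * \prod_i c i).
  rewrite (big_nth 0%N) big_mkord big_split/= prodr_const card_ord.
  by rewrite prodfV invfM mulrCA mulrA.
rewrite -lebesgue_simplex_tuple//; last by rewrite ln_ge0// ler1n.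
apply: le_lebesgue_tuple => t /=.
(* [S] is the outer simplex in row vectors; being convex, it contains the hull once it contains the
   exponent vectors. *)
pose S := [set x : 'rV[R]_(prime_pi y) |
  (forall i, 0 <= x 0 i) /\ \sum_i c i * x 0 i <= ln N%:R].
have cS : convex_set (S : set (convex_lmodType _)).
  move=> a b w; rewrite !inE => -[a_ge0 a_le] [b_ge0 b_le].
  have w0 : 0 <= w%:num by [].
  have w1 : 0 <= 1 - w%:num by rewrite subr_ge0.
  split=> [i|]; first by rewrite !mxE addr_ge0// mulr_ge0.
  under eq_bigr do rewrite !mxE mulrDr ![c _ * (_ * _)]mulrCA.
  rewrite big_split/= -!mulr_sumr.
  rewrite (le_trans (lerD (ler_wpM2l w0 a_le) (ler_wpM2l w1 b_le)))//.
  by rewrite /unstable.onem; lra.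
have /(smallest_sub cS) hullS : [set exponent_vector y n |
    n in [set n | smooth y n /\ (n <= N)%N]] `<=` S.
  move=> _ [n [[n_gt0 _] nN] <-]; split=> [i|]; first by rewrite mxE.
  apply: le_trans (ler_ln_nat R _ _ n_gt0 nN).
  have prod_le := dvdn_leq n_gt0 (prod_primes_upto_dvd y _ n_gt0).
  rewrite (le_trans _ (ler_ln_nat R _ _ _ prod_le))//.
    rewrite -sum_ln_nat; last first.
      by move=> p /primes_upto_prime/prime_gt0; rewrite expn_gt0 => ->.
    rewrite (big_nth 0%N) big_mkord le_eqVlt; apply/orP; left; apply/eqP.
    apply: eq_bigr => i _; rewrite mxE natrX lnXn ?mulr_natr// ltr0n.
    by rewrite prime_gt0// (primes_upto_prime y)// nth_primes_upto.
  rewrite big_seq; apply: prodn_cond_gt0 => p /primes_upto_prime p_prime.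
  by rewrite expn_gt0 prime_gt0.
move/hullS => [t_ge0 t_le]; split=> [i|]; first by have := t_ge0 i; rewrite mxE.
by apply: le_trans t_le; under [leRHS]eq_bigr do rewrite mxE.
Qed.

Lemma volume_hull_ge N y : (0 < N)%N -> 0 <= y ->
  {in primes_upto y, forall p, p <= N}%N ->
  (((prime_pi y)`!%:R^-1 * \prod_(p <- primes_upto y) (trunc_log p N)%:R)%:E <=
   volume (convex_hull
    [set exponent_vector y n | n in [set n | smooth y n /\ (n <= N)%N]]))%E.
Proof.
move=> N_gt0 y_ge0 pN.
pose p (i : 'I_(prime_pi y)) := nth 0%N (primes_upto y) i.
(* The exponent of the largest power of [p i] not exceeding [N]. It is positive because [p i <= N],
   so that dividing by it is harmless. *)
pose b i : R := (trunc_log (p i) N)%:R.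
have p_prime i : prime (p i).
  by rewrite (primes_upto_prime y)// nth_primes_upto.
have b_gt0 i : 0 < b i.
  rewrite ltr0n trunc_log_gt0 prime_gt1//=.
  by rewrite (leq_trans _ (pN _ (nth_primes_upto y i)))// prednK ?prime_gt0.
have -> : (prime_pi y)`!%:R^-1 * \prod_(p <- primes_upto y) (trunc_log p N)%:R
    = 1 ^+ prime_pi y / ((prime_pi y)`!%:R * \prod_i (b i)^-1).
  rewrite (big_nth 0%N) big_mkord expr1n div1r invfM prodfV invrK.
  by [].
rewrite -lebesgue_simplex_tuple// => [|i]; last by rewrite invr_gt0.
apply: le_lebesgue_tuple => t [t_ge0 t_le] /=.
set S := [set _ | _ in _].
have S0 : convex_hull S 0.
  apply: sub_gen_smallest; exists 1%N.
    split=> //; split=> // q q_prime; rewrite dvdn1 => /eqP q1.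
    by rewrite q1 in q_prime.
  by apply/rowP => i; rewrite !mxE logn1.
have Sb i : convex_hull S (b i *: delta_mx 0 i).
  apply: sub_gen_smallest; exists (p i ^ trunc_log (p i) N)%N.
    split; last by rewrite trunc_logP ?prime_gt1.
    split=> [|q q_prime]; first by rewrite expn_gt0 prime_gt0.
    rewrite Euclid_dvdX// => /andP[q_dvd _].
    have /eqP -> : q == p i by rewrite -dvdn_prime2.
    by have := nth_primes_upto y i; rewrite mem_primes_upto// => /andP[].
  apply/rowP => j; rewrite !mxE /= lognX logn_prime//.
  rewrite /p nth_uniq ?primes_upto_uniq//.
  rewrite [X in (_ * nat_of_bool X)%N](_ : _ = (j == i))//.
  by case: eqP => _; rewrite ?muln1 ?mulr1 ?muln0 ?mulr0.
(* A point of the inner simplex is a combination of the axis vertices with weights [tnth t i / b i],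
   whose sum is at most 1; the origin takes the rest. *)
have -> : \row_i tnth t i =
    \sum_i (tnth t i / b i) *: (b i *: delta_mx 0 i) :> 'rV[R]_(prime_pi y).
  rewrite [LHS]row_sum_delta; apply: eq_bigr => i _.
  by rewrite mxE scalerA divfK// gt_eqF.
apply: convex_set_sum => //; first exact: convex_hull_convex.
  by move=> i; rewrite divr_ge0// ltW.
by apply: le_trans t_le; under eq_bigr do rewrite mulrC.
Qed.

(** Take logarithms in [N < p ^ (trunc_log p N).+1]. *)
Lemma ln_ratioB1_le_trunc_log p N : prime p -> (0 < N)%N ->
  ln N%:R / ln p%:R - 1 <= (trunc_log p N)%:R :> R.
Proof.
move=> p_prime N_gt0; rewrite lerBlDr natr1 ler_pdivrMr ?ln_prime_gt0//.
rewrite mulr_natl -lnXn ?ltr0n ?prime_gt0// -natrX.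
by apply: ler_ln_nat => //; rewrite ltnW// trunc_log_ltn// prime_gt1.
Qed.

Lemma exponent_volume_approx N y : (1 < N)%N -> 0 <= y -> y <= N%:R ->
  `|exponent_volume N y - (prime_pi y)`!%:R^-1 *
     \prod_(p <- primes_upto y) (ln N%:R / ln p%:R)| <=
  y * ln 4%:R / ln N%:R * ((prime_pi y)`!%:R^-1 *
     \prod_(p <- primes_upto y) (ln N%:R / ln p%:R)).
Proof.
move=> N_gt1 y_ge0 yN; set V := (X in _ <= _ * X); have N_gt0 := ltnW N_gt1.
have lnN_gt0 : 0 < ln N%:R :> R by rewrite ln_gt0// ltr1n.
have pN : {in primes_upto y, forall p, p <= N}%N.
  move=> p; rewrite mem_primes_upto// => /andP[_ py].
  by rewrite -(ler_nat R) (le_trans py).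
have V_ge0 : 0 <= V.
  rewrite mulr_ge0// big_seq prodr_ge0// => p /primes_upto_prime p_prime.
  by rewrite divr_ge0 ?ltW// ln_prime_gt0.
set c := exponent_volume N y.
pose L : R := (prime_pi y)`!%:R^-1 *
  \prod_(p <- primes_upto y) (trunc_log p N)%:R.
(* The two real bounds also rule out an infinite volume, so [fine] returns its true value. *)
have /andP[Lc cV] : L <= c <= V.
  rewrite /c /exponent_volume; have := volume_hull_le N y N_gt0.
  have := volume_hull_ge N y N_gt0 y_ge0 pN.
  case: (volume _) => [v| |]; rewrite ?leey ?leNye ?lee_fin //=.
  by rewrite -/L -/V => -> ->.
(* As [c <= V], the error is [V - c], and it suffices to bound [L] from below. *)
rewrite distrC ger0_norm ?subr_ge0// lerBlDr -lerBlDl.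
apply: le_trans Lc.
rewrite (_ : V - _ = V * (1 - y * ln 4%:R / ln N%:R)); last by ring.
have theta_le : 1 - y * ln 4%:R / ln N%:R <=
    \prod_(p <- primes_upto y) (1 - ln p%:R / ln N%:R).
  apply: le_trans (prodr_onem_ge _ _ _ _ _); last first.
    move=> p pP; have /ln_prime_gt0 lnp := primes_upto_prime _ _ pP.
    rewrite divr_ge0 ?(ltW lnp) ?(ltW lnN_gt0)//= ler_pdivrMr// mul1r.
    rewrite ler_ln_nat ?pN//.
    by rewrite prime_gt0// (primes_upto_prime y).
  rewrite lerD2l lerN2 -mulr_suml ler_wpM2r ?invr_ge0 ?(ltW lnN_gt0)//.
  exact: sum_ln_primes_upto_le.
apply: le_trans (ler_wpM2l V_ge0 theta_le) _.
rewrite /V /L -mulrA -big_split/= ler_wpM2l// big_seq [leRHS]big_seq.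
apply: ler_prod => p pP; have p_prime := primes_upto_prime _ _ pP.
have lnp := ln_prime_gt0 _ p_prime.
(* Factor by factor, the loss [1 - ln p / ln N] accounts for rounding the axis length down to an
   integer. *)
have -> : ln N%:R / ln p%:R * (1 - ln p%:R / ln N%:R) =
    ln N%:R / ln p%:R - 1 :> R.
  by field; rewrite !gt_eqF.
rewrite ln_ratioB1_le_trunc_log// andbT subr_ge0 ler_pdivlMr// mul1r.
by rewrite ler_ln_nat ?pN// prime_gt0.
Qed.

End exponent_volume.

(** * The asymptotic equivalence *)

Theorem lemma2p1 (R : realType) (y : nat -> R)
    (y_ge2 : forall N : nat, (2 <= N)%N -> 2 <= y N)
    (y_small : (y : nat -> R^o) =o_\oo (fun N : nat => ln N%:R : R^o)) :
  ((fun N => exponent_volume N (y N)) : nat -> R^o) ~_\oo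
  (fun N => (prime_pi (y N))`!%:R^-1 *
     \prod_(p <- primes_upto (y N)) (ln N%:R / ln p%:R) : R^o).
Proof.
apply/eqaddoP => e e_gt0.
have ln4_gt0 : 0 < ln 4%:R :> R by rewrite ln_gt0// ltr1n.
(* The bound [e / ln 4] makes the relative error at most [e]; the bound 1 gives [y N <= ln N < N],
   so that every prime up to [y N] is at most [N]. *)
pose d := Num.min 1 (e / ln 4%:R).
have d_gt0 : 0 < d by rewrite lt_min ltr01 divr_gt0.
have /eqoP/(_ d d_gt0) y_le := y_small.
near=> N.
have N_gt1 : (1 < N)%N by near: N; exact: nbhs_infty_gt.
have y_ge0 : 0 <= y N by apply: le_trans (y_ge2 N N_gt1).
have lnN_gt0 : 0 < ln N%:R :> R by rewrite ln_gt0// ltr1n.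
have yN_le : y N <= d * ln N%:R.
  apply: le_trans (ler_norm _) _; rewrite -[leRHS]ger0_norm; last first.
    by rewrite mulr_ge0// ltW.
  by rewrite normrM (gtr0_norm d_gt0); near: N; exact: y_le.
have yN : y N <= N%:R.
  apply: le_trans yN_le _; apply: le_trans (ltW (ln_sublinear _)).
    by rewrite ler_piMl ?(ltW lnN_gt0)// ge_min lexx.
  by rewrite ltr0n ltnW.
apply: le_trans (exponent_volume_approx _ _ N_gt1 y_ge0 yN) _.
apply: le_trans (ler_wpM2l _ (ler_norm _)) _.
  by rewrite divr_ge0 ?mulr_ge0// ltW.
rewrite ler_wpM2r// ler_pdivrMr// -ler_pdivlMr// mulrAC.
by rewrite (le_trans yN_le)// ler_wpM2r ?(ltW lnN_gt0)// ge_min lexx orbT.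
Unshelve. all: by end_near.
Qed.
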